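(* Let $(E,\hat J,\pi)$ be a pseudoholomorphic vector bundle over an almost complex manifold $(L,J)$. Then there is a normally integrable pseudoholomorphic vector bundle structure $J_0$ on $\pi:E\to (L,J)$ such that $$\hat J=J_0+\tfrac12 J_0\,N_{\hat J}(r,\cdot),$$ where $N_{\hat J}$ is the Nijenhuis tensor of $\hat J$ and $r$ is the radius-vector field on $E$.
   Context: The Nijenhuis tensor of an almost complex structure $J$ is $N_J(X,Y)=[JX,JY]-J[JX,Y]-J[X,JY]-[X,Y]$. A pseudoholomorphic (PH) vector bundle over $(L,J)$ is a real vector bundle $\pi:(E,\hat J)\to(L,J)$ with fiber $F$ such that $\hat J$ is an almost complex structure on the total space, $\pi_*\hat J=J\pi_*$, the restrictions $\hat J|_{F_x}$ to the fibers are constant coefficient complex structures, and there exists a linear (not necessarily $J$-linear) connection $\hat\nabla$ on $\pi$ whose horizontal lifts $T_xL\to T_aE$, $x=\pi(a)$, are complex linear, i.e. split over $\mathbb C$ the sequences $0\to F_x\to T_aE\to T_xL\to0$. For $a\in E$, $x=\pi(a)$, $r_a\in F_x\subset T_aE$ denotes the radius-vector $\vec{xa}$ (so $r=y^s\partial_{y^s}$ in linear fiber coordinates $y^s$). A PH vector bundle structure $J'$ on $E$ is normally integrable if $N_{J'}(X,Y)=0$ whenever $Y$ is a vertical vector (tangent to the fiber), $X$ arbitrary (equivalently, the tensor $N'_{J'}$ obtained by restricting $N_{J'}$ to pairs consisting of one horizontal and one vertical vector vanishes). *)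

(* Defs.v *)
From mathcomp Require Import all_boot all_order all_algebra.
From mathcomp Require Import all_classical all_reals all_analysis.
Set Implicit Arguments.
Unset Strict Implicit.
Unset Printing Implicit Defensive.
Import Order.TTheory GRing.Theory Num.Theory.
Import numFieldNormedType.Exports.
Local Open Scope classical_set_scope.
Local Open Scope ring_scope.

(* C^m on an open set A: the differential x |-> 'd f x exists on A and, for     *)
(* every fixed direction v, x |-> 'd f x v is of class C^(m-1).  It is only     *)
(* used between finite-dimensional spaces, where this is the usual notion.      *)
Fixpoint Ck_on (R : realType) (V W : normedModType R) (m : nat)
    (A : set V) (f : V -> W) : Prop :=
  match m with
  | 0%N => forall x, A x -> {for x, continuous f}
  | m'.+1 => (forall x, A x -> differentiable f x) /\
             (forall v, Ck_on m' A (fun x => 'd f x v))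
  end.

Definition smooth_on (R : realType) (V W : normedModType R)
    (A : set V) (f : V -> W) : Prop := forall m, Ck_on m A f.

(* [cmap] and [cinv] are total functions, meaningful on [cdom] and on [cimg].   *)
Record chart (R : realType) (M : topologicalType) (n : nat) := Chart {
  cdom : set M;
  cmap : M -> 'cV[R]_n;
  cinv : 'cV[R]_n -> M;
  _ : open cdom;
  _ : open (cmap @` cdom);
  _ : forall p, cdom p -> cinv (cmap p) = p;
  _ : forall p, cdom p -> {for p, continuous cmap};
  _ : forall x, (cmap @` cdom) x -> {for x, continuous cinv}
}.

Section Transition.
Variables (R : realType) (M : topologicalType) (n : nat).
Implicit Types c d : chart R M n.

Definition cimg c : set 'cV[R]_n := cmap c @` cdom c.

Definition overlap c d : set 'cV[R]_n :=
  [set x | cimg c x /\ cdom d (cinv c x)].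

Definition transition c d : 'cV[R]_n -> 'cV[R]_n :=
  fun x => cmap d (cinv c x).

End Transition.

(* The atlas may, but need not, be maximal.                                     *)
Record smoothManifold (R : realType) (n : nat) := SmoothManifold {
  mcarrier :> topologicalType;
  atlas : set (chart R mcarrier n);
  _ : hausdorff_space mcarrier;
  _ : @second_countable mcarrier;
  _ : forall p : mcarrier, exists2 c, atlas c & cdom c p;
  _ : forall c d, atlas c -> atlas d -> smooth_on (overlap c d) (transition c d)
}.

Arguments atlas {R n} s.

(* A smooth real vector bundle over L with fiber R^k.  The atlas of the total   *)
(* space consists of bundle charts: c is defined on the preimage of the domain  *)
(* of a chart [vb_base c] of L, has image cimg (vb_base c) x R^k, and its       *)
(* coordinates z = col_mx x y are the base coordinates x = usubmx z and linear  *)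
(* fiber coordinates y = dsubmx z.  In particular the projection reads          *)
(* usubmx in the charts c and [vb_base c], and so does its differential.        *)
(* When the atlas of L is maximal, every smooth vector bundle over L arises in  *)
(* this way, from all its bundle charts.                                        *)
Record vectorBundle (R : realType) (n : nat) (L : smoothManifold R n) (k : nat) :=
  VectorBundle {
  vb_total :> smoothManifold R (n + k);
  vb_proj : vb_total -> L;
  vb_base : chart R vb_total (n + k) -> chart R L n;
  _ : forall c, atlas vb_total c -> atlas L (vb_base c);
  _ : forall p : L, exists2 c, atlas vb_total c & cdom (vb_base c) p;
  _ : forall c, atlas vb_total c -> cdom c = vb_proj @^-1` cdom (vb_base c);
  _ : forall c, atlas vb_total c -> cimg c = usubmx @^-1` cimg (vb_base c);
  _ : forall c, atlas vb_total c -> forall a, cdom c a ->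
        usubmx (cmap c a) = cmap (vb_base c) (vb_proj a);
  _ : forall c d, atlas vb_total c -> atlas vb_total d ->
        exists g : 'cV[R]_n -> 'M[R]_k, forall z, overlap c d z ->
          dsubmx (transition c d z) = g (usubmx z) *m dsubmx z
}.

(* Almost complex structures, given by their matrix in each chart of the atlas; *)
(* the last condition is the transformation law of endomorphisms of the         *)
(* tangent bundle.  Only values at points of [cimg c], for c in the atlas, are  *)
(* meaningful.                                                                  *)
Record almostComplex (R : realType) (n : nat) (M : smoothManifold R n) :=
  AlmostComplex {
  ac_mx :> chart R M n -> 'cV[R]_n -> 'M[R]_n;
  _ : forall c, atlas M c -> smooth_on (cimg c) (ac_mx c);
  _ : forall c, atlas M c -> forall x, cimg c x ->
        ac_mx c x *m ac_mx c x = - 1%:M;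
  _ : forall c d, atlas M c -> atlas M d -> forall x, overlap c d x ->
        forall v : 'cV[R]_n,
        'd (transition c d) x (ac_mx c x *m v) =
        ac_mx d (transition c d x) *m ('d (transition c d) x v)
}.

Section Nijenhuis.
Variables (R : realType) (m : nat).
Implicit Types (J : 'cV[R]_m -> 'M[R]_m) (X Y : 'cV[R]_m -> 'cV[R]_m).

Definition lie_bracket X Y : 'cV[R]_m -> 'cV[R]_m :=
  fun z => 'd Y z (X z) - 'd X z (Y z).

Definition apply_field J X : 'cV[R]_m -> 'cV[R]_m := fun z => J z *m X z.

Definition nijenhuis J X Y : 'cV[R]_m -> 'cV[R]_m := fun z =>
  lie_bracket (apply_field J X) (apply_field J Y) z
  - J z *m lie_bracket (apply_field J X) Y z
  - J z *m lie_bracket X (apply_field J Y) z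
  - lie_bracket X Y z.

End Nijenhuis.

Section PHBundle.
Variables (R : realType) (n : nat) (L : smoothManifold R n).
Variables (k : nat) (E : vectorBundle L k).

(* Horizontal lift, at the point with coordinates z = col_mx x y, of the        *)
(* tangent vector u of L at x, for the connection with Christoffel symbols G:   *)
(* in fiber coordinates, nabla_u s = D_u s + (\sum_i u_i G_i(x)) s.             *)
Definition hor_lift (G : 'cV[R]_n -> 'I_n -> 'M[R]_k)
    (z : 'cV[R]_(n + k)) (u : 'cV[R]_n) : 'cV[R]_(n + k) :=
  col_mx u (- ((\sum_(i < n) u i 0 *: G (usubmx z) i) *m dsubmx z)).

(* The transformation law of the Christoffel symbols is expressed as the        *)
(* independence of the horizontal lift T_xL -> T_aE from the bundle chart.      *)
Record linearConnection := LinearConnection {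
  christoffel : chart R E (n + k) -> 'cV[R]_n -> 'I_n -> 'M[R]_k;
  _ : forall c, atlas E c -> forall i,
        smooth_on (cimg (vb_base c)) (fun x => christoffel c x i);
  _ : forall c d, atlas E c -> atlas E d -> forall z, overlap c d z ->
        forall u : 'cV[R]_n,
        'd (transition c d) z (hor_lift (christoffel c) z u) =
        hor_lift (christoffel d) (transition c d z)
          ('d (transition (vb_base c) (vb_base d)) (usubmx z) u)
}.

Record phBundle (J : almostComplex L) (Jh : almostComplex E) : Prop := PHBundle {
  _ : forall c, atlas E c -> forall z, cimg c z -> forall v : 'cV[R]_(n + k),
        usubmx (Jh c z *m v) = J (vb_base c) (usubmx z) *m usubmx v;
  _ : forall c, atlas E c -> forall z z', cimg c z -> cimg c z' ->
        usubmx z = usubmx z' -> forall w : 'cV[R]_k,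
        Jh c z *m col_mx 0 w = Jh c z' *m col_mx 0 w;
  _ : exists D : linearConnection,
        forall c, atlas E c -> forall z, cimg c z -> forall u : 'cV[R]_n,
        Jh c z *m hor_lift (christoffel D c) z u =
        hor_lift (christoffel D c) z (J (vb_base c) (usubmx z) *m u)
}.

(* X and Y range over the vector fields on the domain of the chart c.           *)
Definition normally_integrable (Jp : almostComplex E) : Prop :=
  forall c, atlas E c -> forall X Y : 'cV[R]_(n + k) -> 'cV[R]_(n + k),
    smooth_on (cimg c) X -> smooth_on (cimg c) Y ->
    (forall z, cimg c z -> usubmx (Y z) = 0) ->
    forall z, cimg c z -> nijenhuis (Jp c) X Y z = 0.

Definition radius_field : 'cV[R]_(n + k) -> 'cV[R]_(n + k) :=
  fun z => col_mx 0 (dsubmx z).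

End PHBundle.

Arguments radius_field {R n k} z.

(* Main.v *)
(* In a bundle chart with base coordinates x and linear fiber coordinates y, a
   pseudoholomorphic structure is determined by J on the base, a complex
   structure C(x) on the fibers and the connection form Gamma of a connection
   with complex linear lifts: it maps (u, w) to (J u, C w + b(u) y), where
   b(u) = C Gamma(u) - Gamma(J u).  A direct computation gives
   N((0, w), (u, v)) = (0, N(u) w) with
     N(u) = b(u) C - C b(u) - D_{J u} C + C D_u C,
   and N(J u) = - C N(u), N(u) C = - C N(u).  Hence replacing Gamma by
   Gamma - N / 4 replaces b by b - C N / 2, which turns N into
   N - C N C / 2 - N / 2 = 0: the new connection defines J_0.  That Gamma - N / 4
   is again a connection amounts to N(u) being an endomorphism of the fiber that
   is compatible with changes of bundle charts; as these are linear in y, only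
   their first derivatives are involved. *)
From HB Require Import structures.
Require Import Defs.
From mathcomp Require Import all_boot all_order all_algebra.
From mathcomp Require Import all_classical all_reals all_analysis.
From mathcomp Require Import ring.
Import Order.TTheory GRing.Theory Num.Theory.
Import numFieldNormedType.Exports.
Local Open Scope classical_set_scope.
Local Open Scope ring_scope.

Set Implicit Arguments.
Unset Strict Implicit.

(** * Continuity and differentials of linear and bilinear maps between matrix spaces *)

Section LinearBilinear.
Context {R : realType}.

Lemma continuous_sum {T : topologicalType} {W : normedModType R} n
    (f : 'I_n -> T -> W) :
  (forall i, continuous (f i)) -> continuous (fun x => \sum_i f i x).
Proof.
move=> fc.
by apply: continuous_big => // p; exact: add_continuous.
Qed.

(** Expansion on the matrix units makes [f] a finite sum of coordinates times fixed vectors, and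
    coordinates are continuous. *)
Lemma linear_mx_continuous {m n} {W : normedModType R}
  (f : {linear 'M[R]_(m, n) -> W}) : continuous f.
Proof.
have fE A : f A = \sum_i \sum_j A i j *: f (delta_mx i j).
  rewrite [in LHS](matrix_sum_delta A) linear_sum; apply: eq_bigr => i _.
  by rewrite linear_sum; apply: eq_bigr => j _; rewrite linearZ.
rewrite (_ : (f : _ -> _) = fun A => \sum_i \sum_j A i j *: f (delta_mx i j));
  last exact/funext.
apply: continuous_sum => i; apply: continuous_sum => j A.
exact: (cvgZr_tmp (@coord_continuous R m n i j A)).
Qed.

Lemma is_diff_linear {m n} {W : normedModType R} (f : 'M[R]_(m, n) -> W) A :
  linear f -> is_diff A f f.
Proof.
move=> lf; pose fM := GRing.isLinear.Build _ _ _ _ _ lf.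
pose fL : {linear _ -> _} := HB.pack f fM.
have fc : continuous fL by exact: linear_mx_continuous.
apply: DiffDef; first exact: (linear_differentiable (f := fL)).
exact: (diff_lin (f := fL)).
Qed.

Section Bilinear.
Context {m n p q : nat} {W : normedModType R}.
Variable f : 'M[R]_(m, n) -> 'M[R]_(p, q) -> W.
Hypotheses (lr : forall A, linear (f A)) (ll : forall B, linear (f^~ B)).

Let bilin_f : bilinear_for (GRing.Scale.Law.clone _ _ *:%R _)
   (GRing.Scale.Law.clone _ _ *:%R _) f.
Proof. by split=> [B|A] a M N; [exact: ll|exact: lr]. Qed.

Let fM := bilinear_isBilinear.Build R _ _ _ _ _ f bilin_f.
Let fL : {bilinear _ -> _ -> _} := HB.pack f fM.

Lemma bilinear_mx_continuous : continuous (fun r => f r.1 r.2).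
Proof.
have fLE (r : 'M[R]_(m, n) * 'M[R]_(p, q)) :
    f r.1 r.2 = \sum_i \sum_j r.1 i j *: f (delta_mx i j) r.2.
  rewrite -[f]/(fL : _ -> _ -> _).
  rewrite [in LHS](matrix_sum_delta r.1) linear_sumlz.
  apply: eq_bigr => i _; rewrite linear_sumlz.
  by apply: eq_bigr => j _; rewrite linearZl_LR.
rewrite (funext fLE); apply: continuous_sum => i; apply: continuous_sum => j.
case=> A B.
have c1 : (fun r : 'M[R]_(m, n) * 'M[R]_(p, q) => r.1 i j) @ (A, B) --> A i j.
  exact: (cvg_comp (fst : 'M[R]_(m, n) * 'M[R]_(p, q) -> _)
    (fun A : 'M[R]_(m, n) => A i j) cvg_fst (@coord_continuous R m n i j A)).
pose gM := GRing.isLinear.Build _ _ _ _ _ (lr (delta_mx i j)).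
pose gL : {linear _ -> _} := HB.pack (f (delta_mx i j)) gM.
have c2 : (fun r : 'M[R]_(m, n) * 'M[R]_(p, q) => gL r.2) @ (A, B) --> gL B.
  have gc : gL @ B --> gL B by exact: linear_mx_continuous.
  exact: (cvg_comp (snd : 'M[R]_(m, n) * 'M[R]_(p, q) -> _) gL cvg_snd gc).
exact: (cvgZ c1 c2).
Qed.

Lemma is_diff_bilinear {V : normedModType R} (u du : V -> 'M[R]_(m, n))
    (v dv : V -> 'M[R]_(p, q)) x :
  is_diff x u du -> is_diff x v dv ->
  is_diff x (fun y => f (u y) (v y)) (fun h => f (u x) (dv h) + f (du h) (v x)).
Proof.
move=> du_ dv_; have fc : continuous (fun r => fL r.1 r.2).
  exact: bilinear_mx_continuous.
pose h := fun y => (u y, v y).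
have dh : is_diff x h (fun y => (du y, dv y)) by exact: is_diff_pair.
rewrite (_ : (fun y => f _ _) = (fun p => fL p.1 p.2) \o h) //.
have db : is_diff (h x) (fun p => fL p.1 p.2)
    (fun q => fL (h x).1 q.2 + fL q.1 (h x).2).
  by apply: DiffDef; [exact: differentiable_bilin|exact: diff_bilin].
exact: (is_diff_eq (is_diff_comp dh db)).
Qed.

End Bilinear.

Lemma is_diff_mulmx {m n p} {V : normedModType R} (u du : V -> 'M[R]_(m, n))
    (v dv : V -> 'M[R]_(n, p)) x :
  is_diff x u du -> is_diff x v dv ->
  is_diff x (fun y => u y *m v y) (fun h => u x *m dv h + du h *m v x).
Proof.
move=> du_ dv_; apply: (is_diff_bilinear (f := fun A B => A *m B)) => //.
  by move=> A a B C; exact: linearP.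
by move=> A a B C; rewrite mulmxDl scalemxAl.
Qed.

End LinearBilinear.

(** * Locality of the differential and closure properties of maps of class C^k *)

Section Ck.
Context {R : realType}.

(** The little-o remainder only sees the germ at [x]. This allows differentiating identities that
    hold only on the image or overlap of charts. *)
Lemma is_diff_near {V W : normedModType R} (f g df : V -> W) x :
  (\near x, f x = g x) -> is_diff x f df -> is_diff x g df.
Proof.
move=> fg [dfx dfE]; have fgx : f x = g x := nbhs_singleton fg.
have [dc /eqaddoP feq] := (diff_locallyP _ _).1 dfx.
have geq : g \o shift x = cst (g x) + 'd f x +o_ 0 id.
  apply/eqaddoP => e e0; move: fg; rewrite (near_shift 0) /= => fg.
  apply: filterS2 fg (feq _ e0) => h; rewrite subr0 => fgh.
  by rewrite !fctE /= fgx fgh.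
have dg : 'd g x = 'd f x :> (V -> W) by exact: diff_unique.
by apply: DiffDef; [apply/diff_locallyP; rewrite dg|rewrite dg].
Qed.

End Ck.

Section CkTheory.
Context {R : realType} {V : normedModType R}.
Implicit Types (A : set V) (W : normedModType R).

Lemma Ck_onW {W} k A (f : V -> W) : Ck_on k.+1 A f -> Ck_on k A f.
Proof.
elim: k f => [|k IH] f [df ddf]; first by move=> x /df /differentiable_continuous.
by split=> // v; exact: IH.
Qed.

(** On an open set, equality at a point is equality of germs there, so it passes to the
    differentials and the induction goes through. *)
Lemma Ck_on_eq {W} k A (f g : V -> W) : open A ->
  (forall x, A x -> f x = g x) -> Ck_on k A f -> Ck_on k A g.
Proof.
move=> oA; elim: k f g => [|k IH] f g fg.
  move=> cf x Ax; suff : g @ x --> f x by rewrite (fg _ Ax).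
  apply: cvg_trans (cf _ Ax); apply: near_eq_cvg.
  by apply: filterS (open_nbhs_nbhs (conj oA Ax)) => y /fg.
have near_fg x : A x -> \near x, f x = g x.
  by move=> Ax; apply: filterS (open_nbhs_nbhs (conj oA Ax)) => y /fg.
move=> [df ddf]; split=> [x Ax|v].
  by have [] := is_diff_near (near_fg _ Ax) (differentiableP (df x Ax)).
apply: IH (ddf v) => x Ax.
by have [_ ->] := is_diff_near (near_fg _ Ax) (differentiableP (df x Ax)).
Qed.

Lemma Ck_on_cst {W} k A (a : W) : Ck_on k A (cst a).
Proof.
elim: k a => [|k IH] a; first by move=> x _; exact: cvg_cst.
split=> [x _|v]; first exact: differentiable_cst.
rewrite (_ : (fun x => _) = cst 0) //; apply/funext => x.
by rewrite diff_cst.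
Qed.

Lemma Ck_on_id k A : Ck_on k A (fun x => x).
Proof.
have aid (x : V) : is_diff x (fun x => x) (fun x => x) by exact: is_diff_id.
case: k => [|k]; first by move=> x _; exact: cvg_id.
split=> [x _|v]; first by have [] := aid x.
rewrite (_ : (fun x => _) = cst v); first exact: Ck_on_cst.
by apply/funext => x; have [_ ->] := aid x.
Qed.

Lemma Ck_onD {W} k A (f g : V -> W) : open A ->
  Ck_on k A f -> Ck_on k A g -> Ck_on k A (fun x => f x + g x).
Proof.
move=> oA; elim: k f g => [|k IH] f g.
  by move=> cf cg x Ax; apply: cvgD; [exact: cf|exact: cg].
move=> [df ddf] [dg ddg]; split=> [x Ax|v].
  by apply: differentiableD; [exact: df|exact: dg].
apply: Ck_on_eq (IH _ _ (ddf v) (ddg v)) => // x Ax.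
by rewrite -[in RHS]/(f + g) diffD; [|exact: df|exact: dg].
Qed.

Lemma Ck_on_sum {W} k A n (f : 'I_n -> V -> W) : open A ->
  (forall i, Ck_on k A (f i)) -> Ck_on k A (fun x => \sum_i f i x).
Proof.
move=> oA cf; rewrite (_ : (fun x => _) = \sum_i f i); last first.
  by apply/funext => x; rewrite fct_sumE.
elim/big_ind: _ => [|g h cg ch|i _]; [exact: Ck_on_cst|exact: Ck_onD|exact: cf].
Qed.

Lemma Ck_on_linear {W} k A m n (l : 'M[R]_(m, n) -> W) (f : V -> 'M[R]_(m, n)) :
  open A -> linear l -> Ck_on k A f -> Ck_on k A (fun x => l (f x)).
Proof.
move=> oA ll; elim: k f => [|k IH] f.
  move=> cf x Ax; have [/differentiable_continuous lc _] := is_diff_linear (f x) ll.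
  exact: (continuous_comp (cf x Ax) lc).
move=> [df ddf].
have dlf x : A x -> is_diff x (fun x => l (f x)) (fun h => l ('d f x h)).
  move=> Ax; exact: (is_diff_comp (differentiableP (df x Ax)) (is_diff_linear _ ll)).
split=> [x /dlf []//|v].
by apply: Ck_on_eq (IH _ (ddf v)) => // x /dlf [_ ->].
Qed.

(** Induction by the Leibniz rule: each term has one differentiated factor, and [Ck_onW] lowers the
    class of the other one to match. *)
Lemma Ck_on_bilinear {W} k A m n p q (b : 'M[R]_(m, n) -> 'M[R]_(p, q) -> W)
    (f : V -> 'M[R]_(m, n)) (g : V -> 'M[R]_(p, q)) :
  open A -> (forall M, linear (b M)) -> (forall N, linear (b^~ N)) ->
  Ck_on k A f -> Ck_on k A g -> Ck_on k A (fun x => b (f x) (g x)).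
Proof.
move=> oA lr ll; elim: k f g => [|k IH] f g.
  move=> cf cg x Ax.
  have cfg : (fun x => (f x, g x)) @ x --> (f x, g x).
    exact: (cvg_pair (cf _ Ax) (cg _ Ax)).
  have cb := @bilinear_mx_continuous _ _ _ _ _ _ _ lr ll (f x, g x).
  exact: (cvg_comp _ (fun r => b r.1 r.2) cfg cb).
move=> cf cg; have [df ddf] := cf; have [dg ddg] := cg.
have dB x : A x -> is_diff x (fun x => b (f x) (g x))
    (fun h => b (f x) ('d g x h) + b ('d f x h) (g x)).
  by move=> Ax; apply: is_diff_bilinear => //; apply: differentiableP;
     [exact: df|exact: dg].
split=> [x /dB []//|v].
have ck := Ck_onD oA (IH _ _ (Ck_onW cf) (ddg v)) (IH _ _ (ddf v) (Ck_onW cg)).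
by apply: Ck_on_eq ck => // x /dB [_ ->].
Qed.

Lemma Ck_on_mulmx k A m n p (f : V -> 'M[R]_(m, n)) (g : V -> 'M[R]_(n, p)) :
  open A -> Ck_on k A f -> Ck_on k A g -> Ck_on k A (fun x => f x *m g x).
Proof.
move=> oA; apply: (Ck_on_bilinear (b := fun M N => M *m N)) => // M a B C.
  exact: linearP.
by rewrite mulmxDl scalemxAl.
Qed.

Lemma Ck_on_scale k A m n p q (f : V -> 'M[R]_(m, n)) i j (g : V -> 'M[R]_(p, q)) :
  open A -> Ck_on k A f -> Ck_on k A g -> Ck_on k A (fun x => f x i j *: g x).
Proof.
move=> oA; apply: (Ck_on_bilinear (b := fun M N => M i j *: N) oA) => M a B C.
  by rewrite scalerDr !scalerA mulrC.
by rewrite !mxE scalerDl scalerA.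
Qed.

End CkTheory.

(** The differential [dh] is the same at all points, so [h] is affine. The derivative of the
    composite along [v] is then the derivative of [f] along the fixed direction [dh v], composed
    with [h], and the induction hypothesis applies to it. *)
Lemma Ck_on_comp {R : realType} {U V W : normedModType R} k (A : set V)
    (f : V -> W) (h dh : U -> V) :
  open A -> (forall z, is_diff z h dh) -> Ck_on k A f ->
  Ck_on k (h @^-1` A) (fun z => f (h z)).
Proof.
move=> oA ah; have ch : continuous h.
  by move=> z; apply: differentiable_continuous; have [] := ah z.
have ohA : open (h @^-1` A) by exact: open_comp.
elim: k f => [|k IH] f.
  by move=> cf z Az; exact: (continuous_comp (ch z) (cf _ Az)).
move=> [df ddf].
have dfh z : A (h z) -> is_diff z (fun z => f (h z)) (fun v => 'd f (h z) (dh v)).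
  by move=> Az; exact: (is_diff_comp (ah z) (differentiableP (df _ Az))).
split=> [z /dfh []//|v].
apply: (Ck_on_eq ohA _ (IH _ (ddf (dh v)))) => z /dfh [_ ->] //.
Qed.

(* Products of matrices are treated as atoms. *)
Ltac mx_lin :=
  repeat match goal with |- context [@mulmx ?S ?a ?b ?c ?A ?B] =>
    move: (@mulmx S a b c A B) => ? end;
  apply/matrixP => ? ?; rewrite !mxE; (ring || field).

(** * Pointwise algebra of the fiber endomorphism N(u) *)

Section FiberAlgebra.
Context {R : realType} {n k : nat}.

(* b(u) and N(u) of the header; [ga] is the connection form, and [D u] stands
   for the derivative of the fiber structure [C] along [u]. *)
Definition lift_defect (J : 'M[R]_n) (C : 'M[R]_k) (ga : 'cV[R]_n -> 'M[R]_k) u :=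
  C *m ga u - ga (J *m u).

Definition nij_end J C ga (D : 'cV[R]_n -> 'M[R]_k) u :=
  lift_defect J C ga u *m C - C *m lift_defect J C ga u - D (J *m u) + C *m D u.

Section Fixed.
Variables (J : 'M[R]_n) (C : 'M[R]_k) (ga D : 'cV[R]_n -> 'M[R]_k).
Hypotheses (JJ : J *m J = - 1%:M) (CC : C *m C = - 1%:M).
Hypotheses (gaN : forall u, ga (- u) = - ga u) (DN : forall u, D (- u) = - D u).
Hypothesis DC : forall u, D u *m C = - (C *m D u).

Let JJu (u : 'cV[R]_n) : J *m (J *m u) = - u.
Proof. by rewrite mulmxA JJ mulNmx mul1mx. Qed.

Let CCl p (X : 'M[R]_(k, p)) : C *m (C *m X) = - X.
Proof. by rewrite mulmxA CC mulNmx mul1mx. Qed.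

Lemma lift_defect_J u : lift_defect J C ga (J *m u) = - (C *m lift_defect J C ga u).
Proof. by rewrite /lift_defect JJu gaN mulmxBr CCl; mx_lin. Qed.

Lemma nij_end_J u : nij_end J C ga D (J *m u) = - (C *m nij_end J C ga D u).
Proof.
rewrite /nij_end lift_defect_J JJu DN; move: (lift_defect J C ga u) => b.
rewrite !(mulmxBr, mulmxDr, mulmxN, mulNmx) !CCl !mulmxA.
by mx_lin.
Qed.

(** The commutator of b(u) with C anticommutes with C because C squares to -1; the derivatives of C
    anticommute with C by [DC]. *)
Lemma nij_end_C u : nij_end J C ga D u *m C = - (C *m nij_end J C ga D u).
Proof.
rewrite /nij_end; move: (lift_defect J C ga u) => b.
rewrite !(mulmxBl, mulmxDl, mulmxBr, mulmxDr, mulNmx, mulmxN) -!mulmxA !DC.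
by rewrite !(CC, mulmxN, mulmx1) !CCl; mx_lin.
Qed.

Let ga0 u := ga u - 4^-1 *: nij_end J C ga D u.

(** The correction enters twice, as - C N(u) / 4 and as N(J u) / 4; by [nij_end_J] the two
    contributions are equal and add up to - C N(u) / 2. *)
Lemma lift_defect_corrected u :
  lift_defect J C ga0 u = lift_defect J C ga u - 2^-1 *: (C *m nij_end J C ga D u).
Proof.
rewrite /lift_defect /ga0 nij_end_J; move: (nij_end J C ga D u) => N.
by rewrite mulmxBr -scalemxAr; mx_lin.
Qed.

(** Only b changes, since C and its derivatives are kept. Anticommutation gives C N C = N, so the
    commutator with C loses N / 2 twice. *)
Lemma nij_end_corrected u : nij_end J C ga0 D u = 0.
Proof.
rewrite {1}/nij_end lift_defect_corrected mulmxBl mulmxBr -scalemxAl -scalemxAr CCl.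
rewrite -mulmxA nij_end_C mulmxN CCl.
(* Unfolding one side of this trivial equation preserves the definition of [N] after [N] is made an
   atom; the difference of the two sides then replaces the right-hand [0]. *)
have : nij_end J C ga D u = nij_end J C ga D u by [].
rewrite {1}/nij_end; move: (nij_end J C ga D u) => N /eqP; rewrite -subr_eq0 => /eqP <-.
by mx_lin.
Qed.

End Fixed.

(** Here [phi] stands for the differential of the base change, [g] for the change of frame and [Dg]
    for its derivative. Both b and the derivative of C transform with extra terms in [Dg], and these
    cancel in N: it is a genuine endomorphism of the fiber. *)
Lemma nij_end_transition (J J' : 'M[R]_n) (C C' g : 'M[R]_k)
    (ga ga' D D' Dg : 'cV[R]_n -> 'M[R]_k) (phi : 'cV[R]_n -> 'cV[R]_n) u :
  C' *m C' = - 1%:M -> C' *m g = g *m C ->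
  (forall u, phi (J *m u) = J' *m phi u) ->
  (forall u, ga' (phi u) *m g = g *m ga u - Dg u) ->
  (forall u, D' (phi u) *m g + C' *m Dg u = Dg u *m C + g *m D u) ->
  nij_end J' C' ga' D' (phi u) *m g = g *m nij_end J C ga D u.
Proof.
move=> CC Cg phiJ gag Dgu.
have {}Dgu v : D' (phi v) *m g = Dg v *m C + g *m D v - C' *m Dg v.
  by rewrite -Dgu addrK.
have {gag} bg v : lift_defect J' C' ga' (phi v) *m g =
    g *m lift_defect J C ga v - C' *m Dg v + Dg (J *m v).
  rewrite /lift_defect -phiJ mulmxBl gag -mulmxA gag !mulmxBr !mulmxA Cg.
  by mx_lin.
rewrite /nij_end -phiJ; move: bg (lift_defect J C ga u) (bg u) => _ b.
move: (lift_defect J' C' ga' (phi u)) => b' bg.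
rewrite !(mulmxBl, mulmxDl, mulNmx) -!mulmxA Cg bg. rewrite !Dgu (mulmxA b') bg.
rewrite !(mulmxBr, mulmxDr, mulmxBl, mulmxDl, mulmxN, mulNmx) !mulmxA.
rewrite CC Cg !mulNmx !mul1mx.
by mx_lin.
Qed.

End FiberAlgebra.

(** * Differentials along lines and the tensorial form of the Nijenhuis bracket *)

Section Differential.
Context {R : realType}.

Lemma diff_line {V W : normedModType R} (f : V -> W) z v c :
  differentiable f z -> (forall t : R, f (z + t *: v) = f z + t *: c) ->
  'd f z v = c.
Proof.
move=> df fl; rewrite -deriveE// /derive; apply: cvg_lim => //.
apply: (@cvg_trans _ ((cst c : R -> W) @ 0^')); last exact: cvg_cst.
apply: near_eq_cvg; near=> t.
rewrite /= [_ *: v + z]addrC fl [f z + _]addrC addrK scalerA mulVf ?scale1r//.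
by near: t; exact: nbhs_dnbhs_neq.
Unshelve. all: by end_near. Qed.

Lemma diff_mulmxl {V : normedModType R} m n p (F : V -> 'M[R]_(m, n)) (a : 'M[R]_(n, p))
    z h : differentiable F z -> 'd F z h *m a = 'd (fun z => F z *m a) z h.
Proof.
move=> dF; have la : linear (fun M : 'M[R]_(m, n) => M *m a).
  by move=> c A B; rewrite mulmxDl scalemxAl.
by have [_ ->] := is_diff_comp (differentiableP dF) (is_diff_linear (F z) la).
Qed.

(** By the product rule, all terms with derivatives of [X] or [Y] cancel because J squares to -1.
    What remains involves only the values of the fields at [z] and the first derivatives of [J]. *)
Lemma nijenhuis_tensor m (J : 'cV[R]_m -> 'M[R]_m) (X Y : 'cV[R]_m -> 'cV[R]_m) z :
  differentiable J z -> differentiable X z -> differentiable Y z ->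
  J z *m J z = - 1%:M ->
  nijenhuis J X Y z =
    'd J z (J z *m X z) *m Y z - 'd J z (J z *m Y z) *m X z
    + J z *m ('d J z (Y z) *m X z) - J z *m ('d J z (X z) *m Y z).
Proof.
move=> dJ dX dY JJ.
have dJF F : differentiable F z -> forall h,
    'd (apply_field J F) z h = J z *m 'd F z h + 'd J z h *m F z.
  move=> dF h.
  have [_ e] := is_diff_mulmx (differentiableP dJ) (differentiableP dF).
  exact: (congr1 (fun l : _ -> _ => l h) e).
have eX := dJF X dX; have eY := dJF Y dY.
have alg (j : 'M[R]_m) (a b c d p q r s A1 A2 A4 A5 : 'cV[R]_m) : j *m j = - 1%:M ->
    A1 = j *m a + p -> A2 = j *m b + q -> A4 = j *m d + r -> A5 = j *m c + s ->
    A1 - A2 - j *m (a - A4) - j *m (A5 - b) - (c - d) = p - q + j *m r - j *m s.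
  move=> jj -> -> -> ->; rewrite !(mulmxBr, mulmxDr) !mulmxA jj !mulNmx !mul1mx.
  by mx_lin.
exact: alg JJ (eY _) (eX _) (eX _) (eY _).
Qed.

End Differential.

Lemma mulmx_ext {R : nzRingType} m n (A B : 'M[R]_(m, n)) :
  (forall v : 'cV_n, A *m v = B *m v) -> A = B.
Proof.
move=> AB; apply/matrixP => i j.
by have /colP/(_ i) := AB (delta_mx j 0); rewrite -!colE !mxE.
Qed.

(** * Pseudoholomorphic structures in one bundle chart and their Nijenhuis tensor *)

Section PhMatrix.
Context {R : realType} {n k : nat}.
Implicit Types (z : 'cV[R]_(n + k)) (u : 'cV[R]_n) (y w : 'cV[R]_k).

Definition conn_form (G : 'I_n -> 'M[R]_k) u : 'M[R]_k := \sum_i u i 0 *: G i.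

Lemma conn_formN G u : conn_form G (- u) = - conn_form G u.
Proof. by rewrite /conn_form -sumrN; apply: eq_bigr => i _; rewrite mxE scaleNr. Qed.

Lemma conn_form_delta G i : conn_form G (delta_mx i 0) = G i.
Proof.
rewrite /conn_form (bigD1 i) //= mxE !eqxx scale1r big1 ?addr0// => j ji.
by rewrite mxE (negPf ji) scale0r.
Qed.

Lemma conn_form_of_linear (f : 'cV[R]_n -> 'M[R]_k) u :
  linear f -> conn_form (fun i => f (delta_mx i 0)) u = f u.
Proof.
move=> lf; pose fM := GRing.isLinear.Build _ _ _ _ _ lf.
pose fL : {linear _ -> _} := HB.pack f fM.
rewrite [in RHS](matrix_sum_delta u) -[f]/(fL : _ -> _) linear_sum.
by apply: eq_bigr => i _; rewrite big_ord1 linearZ.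
Qed.

(** The bilinear expression Gamma(u) y, seen as a matrix acting on u for fixed y; it supplies the
    lower left block of [ph_mx]. *)
Definition conn_form_mx (G : 'I_n -> 'M[R]_k) y : 'M[R]_(k, n) :=
  \sum_i G i *m y *m delta_mx 0 i.

Lemma conn_form_mxE G y u : conn_form_mx G y *m u = conn_form G u *m y.
Proof.
rewrite /conn_form_mx /conn_form !mulmx_suml; apply: eq_bigr => i _.
rewrite -scalemxAl -mulmxA -rowE (_ : row i u = (u i 0)%:M).
  by rewrite mul_mx_scalar.
by apply/matrixP => a b; rewrite !ord1 !mxE eqxx mulr1n.
Qed.

(* Almost complex structure which restricts to [C] on the fibers and for which
   the horizontal lifts of the connection [G] are [J]-linear. *)
Definition ph_mx (J : 'cV[R]_n -> 'M[R]_n) (C : 'cV[R]_n -> 'M[R]_k)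
    (G : 'cV[R]_n -> 'I_n -> 'M[R]_k) z : 'M[R]_(n + k) :=
  let x := usubmx z in let P := conn_form_mx (G x) (dsubmx z) in
  block_mx (J x) 0 (C x *m P - P *m J x) (C x).

Lemma ph_mxE J C G z u w : ph_mx J C G z *m col_mx u w =
  let x := usubmx z in
  col_mx (J x *m u) (lift_defect (J x) (C x) (conn_form (G x)) u *m dsubmx z + C x *m w).
Proof.
rewrite /ph_mx mul_block_col mul0mx addr0 /lift_defect !mulmxBl -!mulmxA !conn_form_mxE.
by rewrite mulmxA.
Qed.

Lemma ph_mx_ver J C G z w :
  ph_mx J C G z *m col_mx 0 w = col_mx 0 (C (usubmx z) *m w).
Proof. by rewrite /ph_mx mul_block_col !mulmx0 mul0mx !add0r. Qed.

Lemma ph_mx_hor J C G z u :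
  ph_mx J C G z *m hor_lift G z u = hor_lift G z (J (usubmx z) *m u).
Proof.
rewrite /hor_lift -/(conn_form _ _) ph_mxE; congr col_mx.
by rewrite /lift_defect mulmxN !mulmxBl -/(conn_form _ _) mulmxA; mx_lin.
Qed.

Lemma hor_lift_split G z (v : 'cV[R]_(n + k)) : v =
  hor_lift G z (usubmx v) +
  col_mx 0 (dsubmx v + conn_form (G (usubmx z)) (usubmx v) *m dsubmx z).
Proof.
by rewrite /hor_lift -/(conn_form _ _) add_col_mx addr0 addrC addrK vsubmxK.
Qed.

Lemma hor_liftN G z u : hor_lift G z (- u) = - hor_lift G z u.
Proof.
by rewrite /hor_lift -!/(conn_form _ _) conn_formN mulNmx opp_col_mx.
Qed.

(** Every vector is a horizontal lift plus a vertical vector; [ph_mx] acts by J on the first summand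
    and by C on the second. *)
Lemma ph_mx_sq J C G z : J (usubmx z) *m J (usubmx z) = - 1%:M ->
  C (usubmx z) *m C (usubmx z) = - 1%:M -> ph_mx J C G z *m ph_mx J C G z = - 1%:M.
Proof.
move=> JJ CC; apply: mulmx_ext => v; rewrite -mulmxA.
move: (hor_lift_split G z v); set a := usubmx v; set b := _ + _ *m dsubmx z.
move: a b => a b ->.
rewrite !mulmxDr !ph_mx_hor !ph_mx_ver !mulmxA JJ CC !mulNmx !mul1mx hor_liftN.
by congr (_ + _); rewrite opp_col_mx oppr0.
Qed.

Section Smooth.
Variables (O : set 'cV[R]_n) (J : 'cV[R]_n -> 'M[R]_n) (C : 'cV[R]_n -> 'M[R]_k).
Variable G : 'cV[R]_n -> 'I_n -> 'M[R]_k.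
Hypotheses (oO : open O) (sJ : smooth_on O J) (sC : smooth_on O C).

Let dusub z : is_diff z (usubmx : 'cV[R]_(n + k) -> 'cV[R]_n) usubmx.
Proof. by apply: is_diff_linear => a u v; exact: linearP. Qed.

Lemma open_usubmx : open ((usubmx : 'cV[R]_(n + k) -> 'cV[R]_n) @^-1` O).
Proof.
apply: open_comp => // z _; apply: differentiable_continuous.
by have [] := dusub z.
Qed.

Lemma smooth_usubmx {W : normedModType R} (f : 'cV[R]_n -> W) : smooth_on O f ->
  smooth_on (usubmx @^-1` O) (fun z : 'cV[R]_(n + k) => f (usubmx z)).
Proof. by move=> sf m; exact: Ck_on_comp dusub (sf m). Qed.

Hypothesis sG : forall i, smooth_on O (G ^~ i).

Lemma smooth_ph_mx : smooth_on (usubmx @^-1` O) (ph_mx J C G).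
Proof.
have oU := open_usubmx.
have sP : smooth_on (usubmx @^-1` O)
    (fun z : 'cV[R]_(n + k) => conn_form_mx (G (usubmx z)) (dsubmx z)).
  move=> m; apply: Ck_on_sum => // i; apply: Ck_on_mulmx => //; last exact: Ck_on_cst.
  apply: Ck_on_mulmx => //; first exact: (smooth_usubmx (sG i) m).
  apply: (Ck_on_linear (l := dsubmx)) => //; last exact: Ck_on_id.
  by move=> a u v; exact: linearP.
move=> m.
have sCu := smooth_usubmx sC m; have sJu := smooth_usubmx sJ m.
have lul : linear (fun a => block_mx a 0 0 0 : 'M[R]_(n + k)).
  by move=> c A B; rewrite scale_block_mx add_block_mx !scaler0 !addr0.
have ldl : linear (fun a => block_mx 0 0 a 0 : 'M[R]_(n + k)).
  by move=> c A B; rewrite scale_block_mx add_block_mx !scaler0 !addr0.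
have ldr : linear (fun a => block_mx 0 0 0 a : 'M[R]_(n + k)).
  by move=> c A B; rewrite scale_block_mx add_block_mx !scaler0 !addr0.
have lN : linear (fun a : 'M[R]_(k, n) => - a).
  by move=> c A B; rewrite opprD scalerN.
have sb := Ck_onD oU (Ck_on_mulmx oU sCu (sP m))
  (Ck_on_linear oU lN (Ck_on_mulmx oU (sP m) sJu)).
have := Ck_onD oU (Ck_onD oU (Ck_on_linear oU lul sJu) (Ck_on_linear oU ldl sb))
  (Ck_on_linear oU ldr sCu).
apply: Ck_on_eq => // z _.
by rewrite !add_block_mx !(addr0, add0r).
Qed.

(** Along a fiber, the image of a fixed vector is affine in the fiber coordinate, with linear
    coefficient b(u). *)
Lemma diff_ph_mx_vertical z a u w : O (usubmx z) ->
  'd (ph_mx J C G) z (col_mx 0 a) *m col_mx u w =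
  col_mx 0 (lift_defect (J (usubmx z)) (C (usubmx z)) (conn_form (G (usubmx z))) u *m a).
Proof.
move=> Oz; have [df _] := smooth_ph_mx 1; rewrite diff_mulmxl; last exact: df.
apply: diff_line => [|t].
  have lM : linear (fun M : 'M[R]_(n + k) => M *m col_mx u w).
    by move=> c A B; rewrite mulmxDl scalemxAl.
  by have [] := is_diff_comp (differentiableP (df z Oz)) (is_diff_linear _ lM).
have tu : usubmx (z + t *: col_mx 0 a) = usubmx z.
  by rewrite linearD linearZ /= col_mxKu scaler0 addr0.
have td : dsubmx (z + t *: col_mx 0 a) = dsubmx z + t *: a.
  by rewrite linearD linearZ /= col_mxKd.
rewrite !ph_mxE /= tu td scale_col_mx add_col_mx scaler0 addr0.
by rewrite mulmxDr scalemxAr addrAC.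
Qed.

(** On vertical vectors the matrix acts by C, which depends on the base point alone, so only the
    base component of [v] contributes. *)
Lemma diff_ph_mx_ver z v w : O (usubmx z) ->
  'd (ph_mx J C G) z v *m col_mx 0 w = col_mx 0 ('d C (usubmx z) (usubmx v) *m w).
Proof.
move=> Oz; have [df _] := smooth_ph_mx 1; rewrite diff_mulmxl; last exact: df.
have [dC _] := sC 1.
have lM : linear (fun M : 'M[R]_k => col_mx 0 (M *m w) : 'cV[R]_(n + k)).
  by move=> c A B; rewrite mulmxDl scale_col_mx add_col_mx scaler0 addr0 scalemxAl.
have [_ e] := is_diff_comp (is_diff_comp (dusub z) (differentiableP (dC _ Oz)))
  (is_diff_linear _ lM).
rewrite (_ : (fun z => _) = (fun M => col_mx 0 (M *m w)) \o (C \o usubmx)).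
  exact: (congr1 (fun l : _ -> _ => l v) e).
by apply/funext => z'; rewrite ph_mx_ver.
Qed.

Hypotheses (JJ : forall x, O x -> J x *m J x = - 1%:M).
Hypotheses (CC : forall x, O x -> C x *m C x = - 1%:M).

(** In the tensorial formula, the two derivatives in vertical directions produce b(u) C and - C
    b(u), and the two derivatives applied to vertical vectors produce the terms in the derivative of
    C. *)
Lemma nijenhuis_ph_mx (X Y : 'cV[R]_(n + k) -> 'cV[R]_(n + k)) z w : O (usubmx z) ->
  differentiable X z -> differentiable Y z -> X z = col_mx 0 w ->
  nijenhuis (ph_mx J C G) X Y z = col_mx 0
    (nij_end (J (usubmx z)) (C (usubmx z)) (conn_form (G (usubmx z))) ('d C (usubmx z))
       (usubmx (Y z)) *m w).
Proof.
move=> Oz dX dY Xw; have [df _] := smooth_ph_mx 1.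
have JJz : ph_mx J C G z *m ph_mx J C G z = - 1%:M by rewrite ph_mx_sq ?JJ ?CC.
have dJ : differentiable (ph_mx J C G) z by exact: df.
rewrite nijenhuis_tensor//.
rewrite Xw -(vsubmxK (Y z)) ph_mx_ver ph_mxE /= !diff_ph_mx_vertical// !diff_ph_mx_ver//.
rewrite !ph_mx_ver !opp_col_mx !add_col_mx !(oppr0, addr0) !col_mxKu; congr col_mx.
rewrite /nij_end; move: (lift_defect _ _ _ _) => b.
by rewrite !(mulmxDl, mulNmx) -!mulmxA; mx_lin.
Qed.

(** Normal integrability has its vertical field in second position, whereas the computation above
    has it in first position. *)
Lemma nijenhuis_ph_mx_sym (X Y : 'cV[R]_(n + k) -> 'cV[R]_(n + k)) z : O (usubmx z) ->
  differentiable X z -> differentiable Y z ->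
  nijenhuis (ph_mx J C G) X Y z = - nijenhuis (ph_mx J C G) Y X z.
Proof.
move=> Oz dX dY; have [df _] := smooth_ph_mx 1.
have JJz : ph_mx J C G z *m ph_mx J C G z = - 1%:M by rewrite ph_mx_sq ?JJ ?CC.
have dJ : differentiable (ph_mx J C G) z by exact: df.
by rewrite !nijenhuis_tensor//; mx_lin.
Qed.

End Smooth.
End PhMatrix.

(** * Differentials of maps that are linear on the fibers *)

Section BundleMap.
Context {R : realType} {n k : nat}.
Variables (O : set 'cV[R]_n) (T : 'cV[R]_(n + k) -> 'cV[R]_(n + k)).
Variables (phi : 'cV[R]_n -> 'cV[R]_n) (g : 'cV[R]_n -> 'M[R]_k).
Hypotheses (oO : open O) (dT : forall z, O (usubmx z) -> differentiable T z).
Hypothesis dphi : forall x, O x -> differentiable phi x.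
Hypothesis TE : forall z, O (usubmx z) ->
  T z = col_mx (phi (usubmx z)) (g (usubmx z) *m dsubmx z).

(** The frame change of a vector bundle is given as a bare function. Its columns are the fiber
    components of [T] at the points (x, e_j), so it inherits the differentiability of [T]. *)
Lemma differentiable_frame x : O x -> differentiable g x.
Proof.
(* Over [O], [gj j x] is the matrix with the column j of [g x] in place and zeros elsewhere. *)
move=> Ox; pose gj j x := dsubmx (T (col_mx x (delta_mx j 0))) *m delta_mx 0 j.
have gE x' : O x' -> (\sum_j gj j) x' = g x'.
  move=> Ox'; rewrite fct_sumE; apply: mulmx_ext => w.
  rewrite [in RHS](matrix_sum_delta w) mulmx_sumr mulmx_suml.
  apply: eq_bigr => j _; rewrite big_ord1 /gj TE col_mxKu// !col_mxKd.
  rewrite -!mulmxA -rowE (_ : row j w = (w j 0)%:M).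
    by rewrite mul_mx_scalar.
  by apply/matrixP => a b; rewrite !ord1 !mxE eqxx mulr1n.
have dgj : differentiable (\sum_j gj j) x.
  apply: differentiable_sum => j.
  have lc : linear (fun x => col_mx x 0 : 'cV[R]_(n + k)).
    by move=> a u v; rewrite scale_col_mx add_col_mx scaler0 addr0.
  have d1 : is_diff x (fun x => col_mx x (delta_mx j 0) : 'cV[R]_(n + k))
      (fun u => col_mx u 0).
    have := is_diffD (is_diff_linear x lc)
      (is_diff_cst (col_mx 0 (delta_mx j 0) : 'cV[R]_(n + k)) x).
    move=> d0; rewrite (_ : (fun x => _) = (fun x => col_mx x 0 : 'cV[R]_(n + k)) +
        cst (col_mx 0 (delta_mx j 0) : 'cV[R]_(n + k))).
      by apply: is_diff_eq; rewrite addr0.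
    by apply/funext => a; rewrite !fctE add_col_mx addr0 add0r.
  have d2 : differentiable T (col_mx x (delta_mx j 0)).
    by apply: dT; rewrite col_mxKu.
  have l3 : linear (fun z : 'cV[R]_(n + k) => dsubmx z *m (delta_mx 0 j : 'rV[R]_k)).
    by move=> a u v; rewrite linearP /= mulmxDl scalemxAl.
  have d12 := is_diff_comp d1 (differentiableP d2).
  by have [] := is_diff_comp d12 (is_diff_linear _ l3).
have near_g : \near x, (\sum_j gj j) x = g x.
  by apply: filterS (open_nbhs_nbhs (conj oO Ox)) => y /gE.
by have [] := is_diff_near near_g (differentiableP dgj).
Qed.

Lemma diff_bundle_map z v : O (usubmx z) -> 'd T z v =
  col_mx ('d phi (usubmx z) (usubmx v))
         (g (usubmx z) *m dsubmx v + 'd g (usubmx z) (usubmx v) *m dsubmx z).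
Proof.
move=> Oz.
have du : is_diff z (usubmx : 'cV[R]_(n + k) -> 'cV[R]_n) usubmx.
  by apply: is_diff_linear => a u w; exact: linearP.
have dd : is_diff z (dsubmx : 'cV[R]_(n + k) -> 'cV[R]_k) dsubmx.
  by apply: is_diff_linear => a u w; exact: linearP.
have lu : linear (fun x => col_mx x 0 : 'cV[R]_(n + k)).
  by move=> a u w; rewrite scale_col_mx add_col_mx scaler0 addr0.
have ld : linear (fun y : 'cV[R]_k => col_mx (0 : 'cV[R]_n) y).
  by move=> a u w; rewrite scale_col_mx add_col_mx scaler0 addr0.
have dp := is_diff_comp du (differentiableP (dphi Oz)).
have dgz := differentiableP (differentiable_frame Oz).
have dg := is_diff_mulmx (is_diff_comp du dgz) dd.
have d0 := is_diffD (is_diff_comp dp (is_diff_linear _ lu))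
  (is_diff_comp dg (is_diff_linear _ ld)).
have near_T : \near z, (((fun x => col_mx x 0) \o (phi \o usubmx)) +
    ((fun y : 'cV[R]_k => col_mx (0 : 'cV[R]_n) y) \o
      (fun z : 'cV[R]_(n + k) => (g \o usubmx) z *m dsubmx z))) z = T z.
  have oU := @open_usubmx R n k O oO.
  apply: filterS (open_nbhs_nbhs (conj oU Oz)) => z' Oz'.
  by rewrite TE// !fctE /= add_col_mx addr0 add0r.
have [_ e] := is_diff_near near_T d0.
have -> := congr1 (fun l : _ -> _ => l v) e.
by rewrite !fctE /= add_col_mx addr0 add0r.
Qed.

End BundleMap.

(** * Charts, bundle charts, and the laws of almost complex structures *)

Section Charts.
Context {R : realType} {M : topologicalType} {n : nat}.
Implicit Types c d : chart R M n.

Lemma open_cimg c : open (cimg c).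
Proof. by case: c. Qed.

Lemma cinvK c x : cimg c x -> cmap c (cinv c x) = x.
Proof. by case: c => U f g ? ? fK ? ? [p /= Up <-]; rewrite fK. Qed.

Lemma cdom_cinv c x : cimg c x -> cdom c (cinv c x).
Proof. by case: c => U f g ? ? fK ? ? [p /= Up <-]; rewrite fK. Qed.

Lemma cmapK c p : cdom c p -> cinv c (cmap c p) = p.
Proof. by case: c => U f g ? ? fK ? ? /= /fK. Qed.

Lemma open_overlap c d : open (overlap c d).
Proof.
rewrite openE => x [cx dx].
apply: (@filterI _ (nbhs x) _ (cimg c) (cinv c @^-1` cdom d)).
  apply: open_nbhs_nbhs; split=> //; exact: open_cimg.
have cc : {for x, continuous (cinv c)} by case: c cx {dx} => ? ? ? ? ? ? ? cc /= /cc.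
have od : open (cdom d) by case: d {dx}.
exact: (cc _ (open_nbhs_nbhs (conj od dx))).
Qed.

Lemma cimg_transition c d z : overlap c d z -> cimg d (transition c d z).
Proof. by move=> [cz dz]; exists (cinv c z). Qed.

End Charts.

Arguments open_cimg {R M n} c.
Arguments open_overlap {R M n} c d.

Section BundleCharts.
Context {R : realType} {n : nat} {L : smoothManifold R n} {k : nat}.
Context {E : vectorBundle L k}.
Implicit Types (c d : chart R E (n + k)) (z : 'cV[R]_(n + k)).

Lemma atlas_vb_base c : atlas E c -> atlas L (vb_base c).
Proof. by case: E c => /= ? ? ? H *; exact: H. Qed.

Lemma cdom_vb_base c : atlas E c -> cdom c = vb_proj (v := E) @^-1` cdom (vb_base c).
Proof. by case: E c => /= ? ? ? ? ? H *; exact: H. Qed.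

Lemma cimg_vb_base c : atlas E c -> cimg c = usubmx @^-1` cimg (vb_base c).
Proof. by case: E c => /= ? ? ? ? ? ? H *; exact: H. Qed.

Lemma usubmx_cmap c a : atlas E c -> cdom c a ->
  usubmx (cmap c a) = cmap (vb_base c) (vb_proj a).
Proof. by case: E c a => /= ? ? ? ? ? ? ? H *; exact: H. Qed.

Lemma cimgE c z : atlas E c -> cimg c z = cimg (vb_base c) (usubmx z).
Proof. by move=> /cimg_vb_base ->. Qed.

Lemma vb_proj_cinv c z : atlas E c -> cimg c z ->
  vb_proj (cinv c z) = cinv (vb_base c) (usubmx z).
Proof.
move=> Ec cz; have cdz := cdom_cinv cz.
rewrite -[in RHS](cinvK cz) usubmx_cmap// cmapK//.
by move: cdz; rewrite cdom_vb_base.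
Qed.

Lemma overlap_vb_base c d z : atlas E c -> atlas E d ->
  overlap c d z <-> overlap (vb_base c) (vb_base d) (usubmx z).
Proof.
move=> Ec Ed; rewrite /overlap /= -cimgE//.
split=> -[cz]; rewrite (cdom_vb_base Ed)/= vb_proj_cinv//.
Qed.

Lemma usubmx_transition c d z : atlas E c -> atlas E d -> overlap c d z ->
  usubmx (transition c d z) = transition (vb_base c) (vb_base d) (usubmx z).
Proof.
move=> Ec Ed [cz dz]; rewrite /transition usubmx_cmap//.
by rewrite vb_proj_cinv.
Qed.

Lemma differentiable_transition (M : smoothManifold R n) (c d : chart R M n) x :
  atlas M c -> atlas M d -> overlap c d x -> differentiable (transition c d) x.
Proof.
case: M c d => /= ? ? ? ? ? H c d cM dM.
by have [df _] := H _ _ cM dM 1; exact: df.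
Qed.

Lemma transition_frame c d : atlas E c -> atlas E d ->
  exists g : 'cV[R]_n -> 'M[R]_k, forall z, overlap c d z ->
          dsubmx (transition c d z) = g (usubmx z) *m dsubmx z.
Proof. by case: E c d => /= ? ? ? ? ? ? ? ? H *; exact: H. Qed.

End BundleCharts.

Lemma linear_conn_form {R : realType} n k (G : 'I_n -> 'M[R]_k) :
  linear (conn_form G).
Proof.
move=> a u v; rewrite /conn_form scaler_sumr -big_split; apply: eq_bigr => i _ /=.
by rewrite !mxE scalerDl scalerA.
Qed.

Lemma linear_nij_end {R : realType} n k (J : 'M[R]_n) (C : 'M[R]_k) ga D :
  linear ga -> linear D -> linear (nij_end J C ga D).
Proof.
move=> lga lD a u v; rewrite /nij_end /lift_defect (mulmxDr J) -(scalemxAr a J) !lga !lD.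
rewrite !(mulmxDr, mulmxDl, mulmxN, mulNmx, =^~ scalemxAl, =^~ scalemxAr).
by mx_lin.
Qed.

Section AlmostComplex.
Context {R : realType} {m : nat} {M : smoothManifold R m} (I : almostComplex M).

Lemma ac_smooth e :
  atlas M e -> smooth_on (cimg e) (I e).
Proof. by case: I => /= ? H *; exact: H. Qed.

Lemma ac_sq e x :
  atlas M e -> cimg e x -> I e x *m I e x = - 1%:M.
Proof. by case: I => /= ? ? H ? ? ?; exact: H. Qed.

Lemma ac_transition e f x v :
  atlas M e -> atlas M f -> overlap e f x ->
  'd (transition e f) x (I e x *m v) =
  I f (transition e f x) *m ('d (transition e f) x v).
Proof. by case: I => /= ? ? ? H ? ? ?; exact: H. Qed.

End AlmostComplex.

(** * The corrected connection and its behavior under changes of bundle charts *)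

Section Correction.
Context {R : realType} {n : nat} {L : smoothManifold R n} {k : nat}.
Context {E : vectorBundle L k}.
Variables (J : almostComplex L) (Jh : almostComplex E) (D : linearConnection E).
Hypothesis Jh_proj : forall c, atlas E c -> forall z, cimg c z ->
  forall v : 'cV[R]_(n + k),
  usubmx (Jh c z *m v) = J (vb_base c) (usubmx z) *m usubmx v.
Hypothesis Jh_fiber : forall c, atlas E c -> forall z z', cimg c z -> cimg c z' ->
  usubmx z = usubmx z' -> forall w : 'cV[R]_k,
  Jh c z *m col_mx 0 w = Jh c z' *m col_mx 0 w.
Hypothesis Jh_hor : forall c, atlas E c -> forall z, cimg c z ->
  forall u : 'cV[R]_n,
  Jh c z *m hor_lift (christoffel D c) z u =
  hor_lift (christoffel D c) z (J (vb_base c) (usubmx z) *m u).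
Implicit Types (c d : chart R E (n + k)) (z : 'cV[R]_(n + k)).
Implicit Types (x u : 'cV[R]_n) (y w : 'cV[R]_k).

(** The fiber structure C(x), read off on the zero section; as it has constant coefficients, it is
    the same at all points of the fiber. *)
Definition fiber_J c x : 'M[R]_k := drsubmx (Jh c (col_mx x 0)).

Definition nij_map c x u : 'M[R]_k :=
  nij_end (J (vb_base c) x) (fiber_J c x) (conn_form (christoffel D c x))
    ('d (fiber_J c) x) u.

Definition christoffel0 c x i : 'M[R]_k :=
  christoffel D c x i - 4^-1 *: nij_map c x (delta_mx i 0).

Lemma cimg_col c x y : atlas E c -> cimg (vb_base c) x -> cimg c (col_mx x y).
Proof. by move=> Ec cx; rewrite cimgE// col_mxKu. Qed.

Lemma cimg_usubmx c z : atlas E c -> cimg c z -> cimg (vb_base c) (usubmx z).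
Proof. by move=> Ec; rewrite cimgE. Qed.

Lemma Jh_ver c z w : atlas E c -> cimg c z ->
  Jh c z *m col_mx 0 w = col_mx 0 (fiber_J c (usubmx z) *m w).
Proof.
move=> Ec cz; rewrite -[LHS]vsubmxK Jh_proj// col_mxKu mulmx0; congr col_mx.
have cz0 : cimg c (col_mx (usubmx z) 0) by apply: cimg_col => //; exact: cimg_usubmx.
rewrite (Jh_fiber Ec cz cz0) ?col_mxKu// /fiber_J.
rewrite -[Jh c _ in LHS]submxK mul_block_col !mulmx0 !add0r.
by rewrite col_mxKd.
Qed.

(** Both structures act by J on the horizontal lifts of [D] and by C on vertical vectors, and these
    span the tangent space. *)
Lemma Jh_ph_mx c z : atlas E c -> cimg c z ->
  Jh c z = ph_mx (J (vb_base c)) (fiber_J c) (christoffel D c) z.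
Proof.
move=> Ec cz; apply: mulmx_ext => v; rewrite (hor_lift_split (christoffel D c) z v).
by rewrite !mulmxDr Jh_hor// Jh_ver// ph_mx_hor ph_mx_ver.
Qed.

Lemma fiber_J_sq c x : atlas E c -> cimg (vb_base c) x ->
  fiber_J c x *m fiber_J c x = - 1%:M.
Proof.
move=> Ec cx; apply: mulmx_ext => w; have cz := cimg_col 0 Ec cx.
have := congr1 (fun A => dsubmx (A *m col_mx 0 w)) (ac_sq Jh Ec cz).
rewrite -mulmxA Jh_ver// Jh_ver// col_mxKu col_mxKd mulmxA => ->.
by rewrite !mulNmx !mul1mx linearN /= col_mxKd.
Qed.

Lemma smooth_base c : atlas E c -> smooth_on (cimg (vb_base c)) (J (vb_base c)).
Proof. by move=> /atlas_vb_base; exact: ac_smooth. Qed.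

Lemma smooth_fiber_J c : atlas E c -> smooth_on (cimg (vb_base c)) (fiber_J c).
Proof.
move=> Ec m; pose h x : 'cV[R]_(n + k) := col_mx x 0.
have hE : h @^-1` cimg c = cimg (vb_base c).
  by apply/funext => x; rewrite /preimage /= cimgE// /h col_mxKu.
have dh x : is_diff x h h.
  by apply: is_diff_linear => a u v; rewrite /h scale_col_mx add_col_mx scaler0 addr0.
have := Ck_on_comp (open_cimg c) dh (ac_smooth Jh Ec m); rewrite hE.
apply: (Ck_on_linear (l := drsubmx)); first exact: open_cimg.
by move=> a A B; apply/matrixP => i j; rewrite !mxE.
Qed.

Lemma smooth_christoffel c i : atlas E c ->
  smooth_on (cimg (vb_base c)) (fun x => christoffel D c x i).
Proof. by case: D => /= G H _ Ec; exact: H. Qed.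

Lemma smooth_nij_map c i : atlas E c ->
  smooth_on (cimg (vb_base c)) (fun x => nij_map c x (delta_mx i 0)).
Proof.
move=> Ec m; have oc := open_cimg (vb_base c).
have sC := smooth_fiber_J Ec m.
have [dC ddC] := smooth_fiber_J Ec m.+1.
have sJ : Ck_on m (cimg (vb_base c))
    (fun x => J (vb_base c) x *m (delta_mx i 0 : 'cV_n)).
  exact: (Ck_on_mulmx oc (smooth_base Ec m) (Ck_on_cst m _ (delta_mx i 0))).
have sG j := smooth_christoffel j Ec m.
have sGJ : Ck_on m (cimg (vb_base c)) (fun x => conn_form (christoffel D c x)
    (J (vb_base c) x *m delta_mx i 0)).
  by apply: Ck_on_sum => // j; exact: Ck_on_scale.
(* The direction varies with [x], while [Ck_on] controls fixed directions only; hence the expansion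
   into partial derivatives with coefficients of class C^m. *)
have sDJ : Ck_on m (cimg (vb_base c)) (fun x => 'd (fiber_J c) x
    (J (vb_base c) x *m delta_mx i 0)).
  have := Ck_on_sum oc (fun j => Ck_on_scale j 0 oc sJ (ddC (delta_mx j 0))).
  apply: Ck_on_eq => // x _; rewrite -[RHS]conn_form_of_linear //.
  by move=> a u v; exact: linearP.
have lN : linear (fun a : 'M[R]_k => - a).
  by move=> a A B; rewrite opprD scalerN.
have sB := Ck_onD oc (Ck_on_mulmx oc sC (sG i)) (Ck_on_linear oc lN sGJ).
have := Ck_onD oc (Ck_onD oc (Ck_onD oc (Ck_on_mulmx oc sB sC)
   (Ck_on_linear oc lN (Ck_on_mulmx oc sC sB))) (Ck_on_linear oc lN sDJ))
   (Ck_on_mulmx oc sC (ddC (delta_mx i 0))).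
apply: Ck_on_eq => // x _.
by rewrite /nij_map /nij_end /lift_defect conn_form_delta.
Qed.

Lemma smooth_christoffel0 c i : atlas E c ->
  smooth_on (cimg (vb_base c)) (fun x => christoffel0 c x i).
Proof.
move=> Ec m; have oc := open_cimg (vb_base c).
have lN : linear (fun a : 'M[R]_k => - (4^-1 *: a)).
  by move=> a A B; rewrite scalerDr opprD scalerN !scalerA mulrC.
exact: (Ck_onD oc (smooth_christoffel i Ec m)
  (Ck_on_linear oc lN (smooth_nij_map i Ec m))).
Qed.

Lemma conn_form_christoffel0 c x u :
  conn_form (christoffel0 c x) u =
  conn_form (christoffel D c x) u - 4^-1 *: nij_map c x u.
Proof.
rewrite -[nij_map c x u]conn_form_of_linear; last first.
  apply: linear_nij_end; first exact: linear_conn_form.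
  by move=> a v w; exact: linearP.
rewrite /conn_form scaler_sumr -sumrB; apply: eq_bigr => i _.
by rewrite /christoffel0 scalerBr !scalerA mulrC.
Qed.

(** Differentiation of the identity that C squares to -1, valid on the open image of the base
    chart. *)
Lemma diff_fiber_J_anti c x u : atlas E c -> cimg (vb_base c) x ->
  'd (fiber_J c) x u *m fiber_J c x = - (fiber_J c x *m 'd (fiber_J c) x u).
Proof.
move=> Ec cx; have [dC _] := smooth_fiber_J Ec 1.
have dCx := differentiableP (dC _ cx).
have [_ e] := is_diff_mulmx dCx dCx.
have near_cst : \near x, (cst (- 1%:M) : _ -> 'M[R]_k) x = fiber_J c x *m fiber_J c x.
  apply: filterS (open_nbhs_nbhs (conj (open_cimg (vb_base c)) cx)) => x' cx'.
  by rewrite fiber_J_sq.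
have [_ e0] := is_diff_near near_cst (is_diff_cst _ x).
have := congr1 (fun l : _ -> _ => l u) (etrans (esym e) e0).
by rewrite /= => /eqP; rewrite addrC addr_eq0 => /eqP.
Qed.

Section Transition.
Variables (c d : chart R E (n + k)) (g : 'cV[R]_n -> 'M[R]_k).
Hypotheses (Ec : atlas E c) (Ed : atlas E d).
Hypothesis gE : forall z, overlap c d z ->
  dsubmx (transition c d z) = g (usubmx z) *m dsubmx z.
Let O := overlap (vb_base c) (vb_base d).
Let phi := transition (vb_base c) (vb_base d).

Let overlapE z : O (usubmx z) -> overlap c d z.
Proof. by move=> Oz; apply/overlap_vb_base. Qed.

Let oO : open O. Proof. exact: open_overlap. Qed.

Let dT z : O (usubmx z) -> differentiable (transition c d) z.
Proof. by move=> /overlapE; exact: differentiable_transition. Qed.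

Let dphi x : O x -> differentiable phi x.
Proof. by apply: differentiable_transition; exact: atlas_vb_base. Qed.

Let TE z : O (usubmx z) ->
  transition c d z = col_mx (phi (usubmx z)) (g (usubmx z) *m dsubmx z).
Proof.
by move=> /overlapE Oz; rewrite -gE// /phi -usubmx_transition// vsubmxK.
Qed.

Lemma diff_transition_vertical z w : O (usubmx z) ->
  'd (transition c d) z (col_mx 0 w) = col_mx 0 (g (usubmx z) *m w).
Proof.
move=> Oz; rewrite (diff_bundle_map oO dT dphi TE)// col_mxKu col_mxKd.
by rewrite !linear0 mul0mx addr0.
Qed.

Lemma fiber_J_transition x : O x -> fiber_J d (phi x) *m g x = g x *m fiber_J c x.
Proof.
move=> Ox; apply: mulmx_ext => w; pose z : 'cV[R]_(n + k) := col_mx x 0.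
have Oz : O (usubmx z) by rewrite col_mxKu.
have [cz dz] := overlapE Oz.
have := ac_transition Jh (col_mx 0 w) Ec Ed (overlapE Oz).
rewrite Jh_ver// !diff_transition_vertical// Jh_ver//; last exact: cimg_transition.
rewrite usubmx_transition// col_mxKu => /(congr1 dsubmx); rewrite !col_mxKd.
by rewrite !mulmxA => ->.
Qed.

(** The usual law of Christoffel symbols: it compares the fiber components of the horizontal lifts
    at (x, y), where the product rule for g(x) y produces the derivative of [g]. *)
Lemma christoffel_transition x u : O x ->
  conn_form (christoffel D d (phi x)) ('d phi x u) *m g x =
  g x *m conn_form (christoffel D c x) u - 'd g x u.
Proof.
move=> Ox; apply: mulmx_ext => y; pose z : 'cV[R]_(n + k) := col_mx x y.
have Oz : O (usubmx z) by rewrite col_mxKu.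
have law : 'd (transition c d) z (hor_lift (christoffel D c) z u) =
    hor_lift (christoffel D d) (transition c d z) ('d phi (usubmx z) u).
  by case: D => /= G _ H; exact: H (overlapE Oz) u.
move: law; rewrite (diff_bundle_map oO dT dphi TE)// /hor_lift -!/(conn_form _ _).
rewrite usubmx_transition//; last exact: overlapE.
rewrite gE; last exact: overlapE.
rewrite !col_mxKu !col_mxKd => /(congr1 dsubmx); rewrite !col_mxKd.
rewrite mulmxN mulmxBl -!mulmxA => /(congr1 -%R); rewrite opprK => <-.
by rewrite opprD opprK.
Qed.

Lemma nij_map_transition x u : O x ->
  nij_map d (phi x) ('d phi x u) *m g x = g x *m nij_map c x u.
Proof.
move=> Ox; have [cx dx] := Ox.
have dphix : cimg (vb_base d) (phi x) by exact: cimg_transition.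
apply: (nij_end_transition (Dg := 'd g x)).
- exact: fiber_J_sq.
- exact: fiber_J_transition.
- by move=> v; apply: ac_transition => //; exact: atlas_vb_base.
- by move=> v; exact: christoffel_transition.
(* The remaining hypothesis is the derivative of [fiber_J_transition], an identity between functions
   on the open overlap. *)
move=> v; have [dCd _] := smooth_fiber_J Ed 1; have [dCc _] := smooth_fiber_J Ec 1.
have dg := differentiableP (differentiable_frame oO dT TE Ox).
have [_ e] := is_diff_mulmx (is_diff_comp (differentiableP (dphi Ox))
  (differentiableP (dCd _ dphix))) dg.
have near_e : \near x, g x *m fiber_J c x = (fiber_J d \o phi) x *m g x.
  apply: filterS (open_nbhs_nbhs (conj oO Ox)) => x' Ox'.
  by rewrite /= fiber_J_transition.
have [_ e'] := is_diff_near near_e (is_diff_mulmx dg (differentiableP (dCc _ cx))).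
rewrite [LHS]addrC [RHS]addrC.
exact: (congr1 (fun l : _ -> _ => l v) (etrans (esym e) e')).
Qed.

(** The new horizontal lift is the old one plus the vertical vector N(u) y / 4. The old part obeys
    the law of [D], and the vertical part is carried over by [nij_map_transition]. *)
Lemma christoffel0_transition z u : O (usubmx z) ->
  'd (transition c d) z (hor_lift (christoffel0 c) z u) =
  hor_lift (christoffel0 d) (transition c d z) ('d phi (usubmx z) u).
Proof.
move=> Oz; have hor0E e z' v : hor_lift (christoffel0 e) z' v =
    hor_lift (christoffel D e) z' v +
    col_mx 0 (4^-1 *: (nij_map e (usubmx z') v *m dsubmx z')).
  rewrite /hor_lift -!/(conn_form _ _) conn_form_christoffel0 add_col_mx addr0.
  by congr col_mx; rewrite mulmxBl opprB addrC -scalemxAl.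
refine (etrans (congr1 _ (hor0E c z u)) (etrans _ (esym (hor0E d _ _)))).
refine (etrans (linearD _ _ _) (congr2 +%R _ _)).
  by case: D => /= G _ H; exact: H (overlapE Oz) u.
rewrite diff_transition_vertical// gE; last exact: overlapE.
rewrite usubmx_transition//; last exact: overlapE.
by rewrite [in RHS]mulmxA nij_map_transition// -scalemxAr mulmxA.
Qed.

End Transition.

End Correction.

(** The tensorial formula uses only the value and the differential of the structure at [z]. It
    serves to replace [Jh] by the [ph_mx] with which it agrees on the image of a chart. *)
Lemma nijenhuis_near {R : realType} m (I J : 'cV[R]_m -> 'M[R]_m)
    (X Y : 'cV[R]_m -> 'cV[R]_m) z :
  (\near z, I z = J z) -> differentiable I z ->
  differentiable X z -> differentiable Y z -> I z *m I z = - 1%:M ->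
  nijenhuis I X Y z = nijenhuis J X Y z.
Proof.
move=> IJ dI dX dY II; have IJz : I z = J z := nbhs_singleton IJ.
have [dJ e] := is_diff_near IJ (differentiableP dI).
have JJ : J z *m J z = - 1%:M by rewrite -IJz.
pose tensor (d : 'cV[R]_m -> 'M[R]_m) (A : 'M[R]_m) :=
  d (A *m X z) *m Y z - d (A *m Y z) *m X z
  + A *m (d (Y z) *m X z) - A *m (d (X z) *m Y z).
exact: (etrans (nijenhuis_tensor dI dX dY II)
  (etrans (congr2 tensor (esym e) IJz) (esym (nijenhuis_tensor dJ dX dY JJ)))).
Qed.

(** * The structure J_0 of the corrected connection, its normal integrability and its relation to
    the given structure *)

Section CorrectedStructure.
Context {R : realType} {n : nat} {L : smoothManifold R n} {k : nat}.
Context {E : vectorBundle L k} {J : almostComplex L} {Jh : almostComplex E}.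
Context {D : linearConnection E}.
Hypothesis Jh_proj : forall c, atlas E c -> forall z, cimg c z ->
  forall v : 'cV[R]_(n + k),
  usubmx (Jh c z *m v) = J (vb_base c) (usubmx z) *m usubmx v.
Hypothesis Jh_fiber : forall c, atlas E c -> forall z z', cimg c z -> cimg c z' ->
  usubmx z = usubmx z' -> forall w : 'cV[R]_k,
  Jh c z *m col_mx 0 w = Jh c z' *m col_mx 0 w.
Hypothesis Jh_hor : forall c, atlas E c -> forall z, cimg c z ->
  forall u : 'cV[R]_n,
  Jh c z *m hor_lift (christoffel D c) z u =
  hor_lift (christoffel D c) z (J (vb_base c) (usubmx z) *m u).

Let chr0 := christoffel0 J Jh D.

Lemma christoffel0_law c d : atlas E c -> atlas E d -> forall z, overlap c d z ->
  forall u : 'cV[R]_n,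
  'd (transition c d) z (hor_lift (chr0 c) z u) =
  hor_lift (chr0 d) (transition c d z)
    ('d (transition (vb_base c) (vb_base d)) (usubmx z) u).
Proof.
move=> Ec Ed z Oz u; have [g gE] := transition_frame Ec Ed.
have Ox := (overlap_vb_base z Ec Ed).1 Oz.
exact: (christoffel0_transition D Jh_proj Jh_fiber Ec Ed gE u Ox).
Qed.

Definition connection0 : linearConnection E :=
  LinearConnection (fun c Ec i => smooth_christoffel0 J Jh D i Ec)
    christoffel0_law.

Let J0 c := ph_mx (J (vb_base c)) (fiber_J Jh c) (chr0 c).

Lemma J0_smooth c : atlas E c -> smooth_on (cimg c) (J0 c).
Proof.
move=> Ec; rewrite (cimg_vb_base Ec); apply: smooth_ph_mx.
- exact: open_cimg.
- exact: smooth_base.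
- exact: smooth_fiber_J.
- by move=> i; exact: smooth_christoffel0.
Qed.

Lemma J0_sq c : atlas E c -> forall z, cimg c z -> J0 c z *m J0 c z = - 1%:M.
Proof.
move=> Ec z cz; have cx := cimg_usubmx Ec cz; apply: ph_mx_sq.
  by apply: ac_sq => //; exact: atlas_vb_base.
exact: (fiber_J_sq Jh_proj Jh_fiber Ec cx).
Qed.

(** Changes of charts respect the splitting into lifts of the new connection and vertical vectors.
    The law then reduces to that of J on the base and that of C on the fibers. *)
Lemma J0_law c d : atlas E c -> atlas E d -> forall z, overlap c d z ->
  forall v : 'cV[R]_(n + k),
  'd (transition c d) z (J0 c z *m v) =
  J0 d (transition c d z) *m ('d (transition c d) z v).
Proof.
move=> Ec Ed z Oz v; have Ox := (overlap_vb_base z Ec Ed).1 Oz.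
have [g gE] := transition_frame Ec Ed.
have dTE u w : 'd (transition c d) z (hor_lift (chr0 c) z u + col_mx 0 w) =
    hor_lift (chr0 d) (transition c d z)
      ('d (transition (vb_base c) (vb_base d)) (usubmx z) u)
    + col_mx 0 (g (usubmx z) *m w).
  refine (etrans (linearD _ _ _) (congr2 +%R _ _)); first exact: christoffel0_law.
  exact: (diff_transition_vertical Ec Ed gE).
rewrite (hor_lift_split (chr0 c) z v); move: (usubmx v) (dsubmx v + _) => u w.
rewrite mulmxDr ph_mx_hor ph_mx_ver.
refine (etrans (dTE _ _) (esym (etrans (congr1 _ (dTE _ _)) _))).
rewrite mulmxDr ph_mx_hor ph_mx_ver usubmx_transition//.
refine (congr2 +%R (congr1 _ (esym _)) (congr1 _ _)).
  by apply: ac_transition => //; exact: atlas_vb_base.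
by rewrite !mulmxA (fiber_J_transition Jh_proj Jh_fiber Ec Ed gE).
Qed.

Definition corrected : almostComplex E := AlmostComplex J0_smooth J0_sq J0_law.

Lemma phBundle_corrected : phBundle J corrected.
Proof.
split=> [c Ec z cz v|c Ec z z' cz cz' zz' w|].
- by rewrite /= -[v in LHS]vsubmxK /J0 ph_mxE col_mxKu.
- by rewrite /= /J0 !ph_mx_ver zz'.
- by exists connection0 => c Ec z cz u; exact: ph_mx_hor.
Qed.

Section Curvature.
Variables (c : chart R E (n + k)) (x : 'cV[R]_n).
Hypotheses (Ec : atlas E c) (cx : cimg (vb_base c) x).

Let JJ : J (vb_base c) x *m J (vb_base c) x = - 1%:M.
Proof. by apply: ac_sq => //; exact: atlas_vb_base. Qed.

Let CC : fiber_J Jh c x *m fiber_J Jh c x = - 1%:M.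
Proof. exact: (fiber_J_sq Jh_proj Jh_fiber Ec cx). Qed.

Let DC u : 'd (fiber_J Jh c) x u *m fiber_J Jh c x =
  - (fiber_J Jh c x *m 'd (fiber_J Jh c) x u).
Proof. exact: (diff_fiber_J_anti Jh_proj Jh_fiber u Ec cx). Qed.

Let DN u : 'd (fiber_J Jh c) x (- u) = - 'd (fiber_J Jh c) x u.
Proof. exact: linearN. Qed.

Let chr0E : conn_form (chr0 c x) =
  fun u => conn_form (christoffel D c x) u - 4^-1 *: nij_map J Jh D c x u.
Proof. by apply/funext => u; exact: conn_form_christoffel0. Qed.

Lemma nij_end0 u : nij_end (J (vb_base c) x) (fiber_J Jh c x) (conn_form (chr0 c x))
  ('d (fiber_J Jh c) x) u = 0.
Proof. by rewrite chr0E; apply: nij_end_corrected => // v; exact: conn_formN. Qed.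

Lemma lift_defect0 u :
  lift_defect (J (vb_base c) x) (fiber_J Jh c x) (conn_form (chr0 c x)) u =
  lift_defect (J (vb_base c) x) (fiber_J Jh c x) (conn_form (christoffel D c x)) u
  - 2^-1 *: (fiber_J Jh c x *m nij_map J Jh D c x u).
Proof. by rewrite chr0E; apply: lift_defect_corrected => // v; exact: conn_formN. Qed.

End Curvature.

Lemma normally_integrable_corrected : normally_integrable corrected.
Proof.
move=> c Ec X Y sX sY Yver z cz; have cx := cimg_usubmx Ec cz.
have [dX _] := sX 1; have [dY _] := sY 1.
have oc := open_cimg (vb_base c).
have sJ := smooth_base J Ec; have sC := smooth_fiber_J Jh Ec.
have sG i := smooth_christoffel0 J Jh D i Ec.
have JJ x : cimg (vb_base c) x -> J (vb_base c) x *m J (vb_base c) x = - 1%:M.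
  by apply: ac_sq => //; exact: atlas_vb_base.
have CC x := fiber_J_sq Jh_proj Jh_fiber (x := x) Ec.
have Yz : Y z = col_mx 0 (dsubmx (Y z)) by rewrite -[LHS]vsubmxK Yver.
rewrite (nijenhuis_ph_mx_sym oc sJ sC sG JJ CC cx (dX _ cz) (dY _ cz)).
rewrite (nijenhuis_ph_mx oc sJ sC sG JJ CC cx (dY _ cz) (dX _ cz) Yz).
by rewrite nij_end0// mul0mx col_mx0 oppr0.
Qed.

(** The radius field at (x, y) is (0, y), so the Nijenhuis term is the vertical vector N(u) y, on
    which J_0 acts by C. Half of C N(u) y is exactly what [lift_defect0] subtracts from b(u) y. *)
Lemma correctedE c : atlas E c -> forall X, smooth_on (cimg c) X ->
  forall z, cimg c z -> Jh c z *m X z = corrected c z *m X z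
    + 2^-1 *: (corrected c z *m nijenhuis (Jh c) radius_field X z).
Proof.
move=> Ec X sX z cz; have cx := cimg_usubmx Ec cz; have [dX _] := sX 1.
have oc := open_cimg (vb_base c).
have sJ := smooth_base J Ec; have sC := smooth_fiber_J Jh Ec.
have sG i := smooth_christoffel D i Ec.
have JJ x : cimg (vb_base c) x -> J (vb_base c) x *m J (vb_base c) x = - 1%:M.
  by apply: ac_sq => //; exact: atlas_vb_base.
have CC x := fiber_J_sq Jh_proj Jh_fiber (x := x) Ec.
have dr : differentiable (radius_field : 'cV[R]_(n + k) -> _) z.
  have lr : linear (radius_field : 'cV[R]_(n + k) -> 'cV[R]_(n + k)).
    move=> a u v; rewrite /radius_field linearP /= scale_col_mx add_col_mx.
    by rewrite scaler0 addr0.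
  by have [] := is_diff_linear z lr.
have [dJh _] := ac_smooth Jh Ec 1.
have JhE := Jh_ph_mx Jh_proj Jh_fiber Jh_hor Ec.
rewrite (@nijenhuis_near _ _ _ (ph_mx (J (vb_base c)) (fiber_J Jh c) (christoffel D c))) //.
- rewrite (nijenhuis_ph_mx oc sJ sC sG JJ CC cx dr (dX _ cz) (w := dsubmx z))//.
  rewrite JhE// ph_mx_ver -[X z]vsubmxK !ph_mxE col_mxKu scale_col_mx scaler0 add_col_mx.
  rewrite addr0 lift_defect0// mulmxBl -scalemxAl; congr col_mx.
  by rewrite mulmxA; mx_lin.
- by apply: filterS (open_nbhs_nbhs (conj (open_cimg c) cz)) => z' cz'; exact: JhE.
- exact: dJh.
- exact: dX.
- exact: ac_sq.
Qed.

End CorrectedStructure.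

Unset Implicit Arguments.
Set Strict Implicit.

Theorem theorem15 (R : realType) (n k : nat) (L : smoothManifold R n)
    (E : vectorBundle L k) (J : almostComplex L) (Jh : almostComplex E)
    (PH : phBundle J Jh) :
  exists J0 : almostComplex E,
    [/\ phBundle J J0,
        normally_integrable J0
      & forall c : chart R E (n + k), atlas E c ->
        forall X : 'cV[R]_(n + k) -> 'cV[R]_(n + k), smooth_on (cimg c) X ->
        forall z : 'cV[R]_(n + k), cimg c z ->
        Jh c z *m X z =
        J0 c z *m X z
        + 2^-1 *: (J0 c z *m nijenhuis (Jh c) radius_field X z)].
Proof.
case: PH => Jh_proj Jh_fiber [D Jh_hor].
exists (corrected (D := D) Jh_proj Jh_fiber); split.
- exact: phBundle_corrected.
- exact: normally_integrable_corrected.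
- by move=> c Ec X sX z cz; exact: correctedE.
Qed.
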